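(* Consider the optimal nudging algorithm (described in the context) applied to a semi-Markov decision process with bound $D$, assuming each call to the cumulative-reward reinforcement learning solver returns an optimal policy and its exact value. Then the number $n$ of calls to the solver required to make the length of the uncertainty interval of the optimal gain at most $\varepsilon$ (unless the algorithm has already terminated, having solved the task) satisfies $$n=O\left(\log\left(\frac{D}{\varepsilon}\right)\right)$$ as $D/\varepsilon\to\infty$, with a constant independent of the process, of $D$ and of $\varepsilon$.
   Context: Setting. A semi-Markov decision process has finite state and action sets and is unichain (every policy has only one recurrent class), with a fixed recurrent state $s_I$ (belonging to the recurrent class of every policy). $\Pi$ is the finite set of deterministic stationary policies. For $\pi\in\Pi$, $v^\pi$ and $c^\pi$ are the expected total reward and expected total action cost accumulated between leaving $s_I$ and first returning to $s_I$; $c^\pi\ge1$. The gain of $\pi$ is $v^\pi/c^\pi$, and $\rho^*=\max_{\pi\in\Pi} v^\pi/c^\pi$ is the optimal gain; at least one policy has positive gain. $D>0$ is a constant with $-D\le v^\pi\le D$ for all $\pi$. A policy $\pi$ is mapped to $w^\pi=\frac{D+v^\pi}{2c^\pi}$, $l^\pi=\frac{D-v^\pi}{2c^\pi}$. For a point $X=(w_X,l_X)$ put $X_1=\frac{w_X-l_X}{2}$. Uncertainties. Let $A,B,C$ be the vertices of a triangle in $\{w\ge 0,l\ge 0,w+l\le D\}$ for which the line $AB$ has slope $1$ with $B$ above $A$, $C$ lies below the line $AB$, the line $AC$ has slope in $[0,1]$, the line $BC$ has slope of absolute value at least $1$ (possibly infinite), and all vertices satisfy $w\ge l$; thus $A_1=B_1\le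 C_1$. Such a triangle, known to contain the image of a gain-optimal policy, gives the uncertainty interval $2B_1\le\rho^*\le 2C_1$ of length $2(C_1-B_1)$. For $\rho_x$ with $B_1\le\frac{\rho_x}{2}\le C_1$ and real $v$, let $L_v$ be the line through $\left(\frac{\rho_x}{2},-\frac{\rho_x}{2}\right)$ with slope $\frac{D-v}{D+v}$ (vertical if $v=-D$); only $v$ for which $L_v$ meets the triangle are considered. Let $T$ be the point of $L_v\cap\overline{AC}$ (the one closest to $A$, if several). For $v\le 0$ let $S$ be the point where $L_v$ meets $\overline{AB}\cup\overline{BC}$ and $u_l=2(T_1-S_1)$; for $v\ge0$ let $S$ be the point where $L_v$ meets $\overline{BC}$ and $u_r=2(S_1-T_1)$; both are taken to be $0$ if $v=0$. Let $u_l^*(\rho_x)$ and $u_r^*(\rho_x)$ be the maxima of $u_l$ over considered $v\le0$ and of $u_r$ over considered $v\ge 0$. Algorithm (optimal nudging). Start with $A=(0,0)$, $B=\left(\frac D2,\frac D2\right)$, $C=(D,0)$, so the initial uncertainty interval is $[0,D]$. Repeat: 1. Choose $\rho_i$ minimizing $\max[u_l^*(\rho_x),u_r^*(\rho_x)]$ over $B_1\le\frac{\rho_x}{2}\le C_1$. 2. Call the solver on the cumulative-reward problem with rewards (reward) $-\rho_i\cdot$(cost), obtaining an optimal policy $\pi_i^*$ and its value $v_i^*=\max_{\pi\in\Pi}(v^\pi-\rho_i c^\pi)$ at $s_I$. 3. If $v_i^*=0$, stop: $\rho^*=\rho_i$. If $\pi_i^*=\pi_{i-1}^*$ and $v_i^*,v_{i-1}^*$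 have opposite signs, stop: $\pi_i^*$ is gain-optimal. 4. Otherwise replace the triangle, using $L=L_{v_i^*}$ for $\rho_x=\rho_i$. If $v_i^*<0$ and $L$ meets $\overline{AB}$: the new vertices are $A'=A$, $B'=L\cap\overline{AB}$, $C'=L\cap\overline{AC}$. If $v_i^*<0$ and $L$ meets $\overline{BC}$: $B'=L\cap\overline{BC}$, $C'=L\cap\overline{AC}$, and $A'$ is the intersection of $\overline{AC}$ with the line of slope $1$ through $B'$. If $v_i^*>0$: $C'=L\cap\overline{BC}$, $A'=L\cap\overline{AC}$, and $B'$ is the intersection of $\overline{BC}$ with the line of slope $1$ through $A'$. If the new triangle degenerates to a point or to a segment with $A'_1=B'_1=C'_1$, the optimal gain is determined and the algorithm stops. *)

(* Defs.v *)
From HB Require Import structures.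
From mathcomp Require Import all_boot all_order all_algebra.
From mathcomp Require Import all_classical all_reals all_analysis.

Set Implicit Arguments.
Unset Strict Implicit.
Unset Printing Implicit Defensive.

Import Order.TTheory GRing.Theory Num.Theory numFieldNormedType.Exports.
Local Open Scope classical_set_scope.
Local Open Scope ring_scope.

(** * Semi-Markov decision processes *)

(* [reward s a t] and [cost s a t] are the expected reward and the expected
   action cost (e.g. the sojourn time) of a transition from s to t under a;
   only these expectations enter the values of policies. *)
Record smdp (R : realType) (S A : finType) := SMDP {
  trans : S -> A -> S -> R;
  reward : S -> A -> S -> R;
  cost : S -> A -> S -> R;
  trans_ge0 : forall s a t, 0 <= trans s a t;
  trans_sum1 : forall s a, \sum_t trans s a t = 1 }.

Section Policies.
Context {R : realType} {S A : finType} (M : smdp R S A).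

Definition policy : finType := {ffun S -> A}.

Implicit Types (pi : policy) (s t : S).

Fixpoint path_prob pi s (p : seq S) : R :=
  if p is t :: p' then trans M s (pi s) t * path_prob pi t p' else 1.

Fixpoint path_total (f : S -> A -> S -> R) pi s (p : seq S) : R :=
  if p is t :: p' then f s (pi s) t + path_total f pi t p' else 0.

(* The excursions from s with first return to s at time n.+1 are the paths
   s, p_1, ..., p_n, s whose intermediate states all differ from s. *)
Definition return_prob_at pi s (n : nat) : R :=
  \sum_(p : n.-tuple S | s \notin p) path_prob pi s (rcons p s).

Definition return_total_at (f : S -> A -> S -> R) pi s (n : nat) : R :=
  \sum_(p : n.-tuple S | s \notin p)
    path_prob pi s (rcons p s) * path_total f pi s (rcons p s).

Definition recurrent pi s : Prop :=
  series (return_prob_at pi s) @ \oo --> (1 : R).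

Definition reaches pi : rel S :=
  connect (fun s t => 0 < trans M s (pi s) t).

Definition recurrent_class pi (K : {set S}) : Prop :=
  exists2 s, recurrent pi s &
    K = [set t | reaches pi s t && reaches pi t s]%SET.

Definition unichain : Prop :=
  forall pi, exists! K : {set S}, recurrent_class pi K.

Definition recurrent_state (sI : S) : Prop :=
  forall pi (K : {set S}), recurrent_class pi K -> sI \in K.

(* Expected total of f between leaving s and first returning to s, as the
   expectation over all excursions from s. *)
Definition cycle_total (f : S -> A -> S -> R) pi s : R :=
  lim (series (return_total_at f pi s) @ \oo).

Definition cycle_reward (sI : S) pi : R := cycle_total (reward M) pi sI.

Definition cycle_cost (sI : S) pi : R := cycle_total (cost M) pi sI.

Definition gain (sI : S) pi : R := cycle_reward sI pi / cycle_cost sI pi.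

(* The value at sI of pi for the rewards (reward) - rho * (cost). *)
Definition nudged_value (sI : S) (rho : R) pi : R :=
  cycle_reward sI pi - rho * cycle_cost sI pi.

Definition nudged_optimal (sI : S) (rho : R) pi : Prop :=
  forall pi', nudged_value sI rho pi' <= nudged_value sI rho pi.

End Policies.

(** * The w-l plane *)

Record point (R : Type) := Point { wcoord : R; lcoord : R }.

Record triangle (R : Type) :=
  Triangle { vA : point R; vB : point R; vC : point R }.

Section Plane.
Context {R : realType}.
Implicit Types (X Y P Q S T : point R) (Tr : triangle R) (D rho v u : R).

(* X_1 *)
Definition coord1 X : R := (wcoord X - lcoord X) / 2.

Definition segment P Q : set (point R) :=
  [set X | exists t : R, [/\ 0 <= t, t <= 1,
     wcoord X = (1 - t) * wcoord P + t * wcoord Q &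
     lcoord X = (1 - t) * lcoord P + t * lcoord Q]].

Definition triangle_set Tr : set (point R) :=
  [set X | exists a b c : R, [/\ [/\ 0 <= a, 0 <= b & 0 <= c], a + b + c = 1,
     wcoord X = a * wcoord (vA Tr) + b * wcoord (vB Tr) + c * wcoord (vC Tr) &
     lcoord X = a * lcoord (vA Tr) + b * lcoord (vB Tr) + c * lcoord (vC Tr)]].

(* The line through P of slope 1. *)
Definition diag_line P : set (point R) :=
  [set X | lcoord X - lcoord P = wcoord X - wcoord P].

(* L_v, for the reference gain rho. *)
Definition nudge_line D rho v : set (point R) :=
  [set X | if v == - D then wcoord X = rho / 2
           else lcoord X + rho / 2 = (D - v) / (D + v) * (wcoord X - rho / 2)].

Definition sqdist P Q : R :=
  (wcoord P - wcoord Q) ^+ 2 + (lcoord P - lcoord Q) ^+ 2.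

Definition is_T D Tr rho v T : Prop :=
  let I := nudge_line D rho v `&` segment (vA Tr) (vC Tr) in
  I T /\ forall X, I X -> sqdist (vA Tr) T <= sqdist (vA Tr) X.

Definition considered D Tr rho v : Prop :=
  nudge_line D rho v `&` triangle_set Tr !=set0.

Definition u_l_set D Tr rho : set R :=
  [set u | exists v, [/\ v <= 0, considered D Tr rho v &
     if v == 0 then u = 0 else
     exists S T, [/\ (nudge_line D rho v `&`
                        (segment (vA Tr) (vB Tr) `|` segment (vB Tr) (vC Tr))) S,
                     is_T D Tr rho v T & u = 2 * (coord1 T - coord1 S)]]].

Definition u_r_set D Tr rho : set R :=
  [set u | exists v, [/\ 0 <= v, considered D Tr rho v &
     if v == 0 then u = 0 else
     exists S T, [/\ (nudge_line D rho v `&` segment (vB Tr) (vC Tr)) S,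
                     is_T D Tr rho v T & u = 2 * (coord1 S - coord1 T)]]].

(* The suprema below are attained for the triangles met by the algorithm. *)
Definition u_l_star D Tr rho : R := sup (u_l_set D Tr rho).

Definition u_r_star D Tr rho : R := sup (u_r_set D Tr rho).

Definition worst_uncertainty D Tr rho : R :=
  Num.max (u_l_star D Tr rho) (u_r_star D Tr rho).

Definition admissible_gain Tr rho : Prop :=
  coord1 (vB Tr) <= rho / 2 <= coord1 (vC Tr).

Definition optimal_nudge D Tr rho : Prop :=
  admissible_gain Tr rho /\
  forall rho', admissible_gain Tr rho' ->
    worst_uncertainty D Tr rho <= worst_uncertainty D Tr rho'.

Definition uncertainty_length Tr : R := 2 * (coord1 (vC Tr) - coord1 (vB Tr)).

Definition initial_triangle D : triangle R :=
  Triangle (Point 0 0) (Point (D / 2) (D / 2)) (Point D 0).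

Definition degenerate Tr : Prop :=
  coord1 (vA Tr) = coord1 (vB Tr) /\ coord1 (vB Tr) = coord1 (vC Tr).

(* Passage from Tr to Tr' after the solver has returned the value v for rho. *)
Definition update D Tr rho v Tr' : Prop :=
  let L := nudge_line D rho v in
  let: Triangle A B C := Tr in
  let: Triangle A' B' C' := Tr' in
  [\/ [/\ v < 0, A' = A, (L `&` segment A B) B' & is_T D Tr rho v C'],
      [/\ v < 0, (L `&` segment B C) B', is_T D Tr rho v C' &
          (segment A C `&` diag_line B') A'] |
      [/\ 0 < v, (L `&` segment B C) C', is_T D Tr rho v A' &
          (segment B C `&` diag_line A') B']].

End Plane.

(** * Optimal nudging *)

(* Solver calls are numbered from 0: [exec_tri e i] is the triangle before call
   i, [exec_rho e i] the gain chosen for call i and [exec_pol e i] the policy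
   returned by it.  Entries past termination are meaningless. *)
Record execution (R : realType) (S A : finType) := Execution {
  exec_tri : nat -> triangle R;
  exec_rho : nat -> R;
  exec_pol : nat -> @policy S A }.

Section Execution.
Context {R : realType} {S A : finType} (M : smdp R S A) (sI : S) (D : R).
Implicit Types (e : execution R S A) (i n : nat).

Definition exec_val e i : R := nudged_value M sI (exec_rho e i) (exec_pol e i).

Definition solved_at e i : Prop :=
  exec_val e i = 0 \/
  [/\ (0 < i)%N, exec_pol e i = exec_pol e i.-1 &
      exec_val e i * exec_val e i.-1 < 0].

Definition stops_at e i : Prop :=
  solved_at e i \/ degenerate (exec_tri e i.+1).

Definition stopped_before e n : Prop := exists2 i, (i < n)%N & stops_at e i.

Definition nudging_execution e : Prop :=
  exec_tri e 0 = initial_triangle D /\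
  forall i, ~ stopped_before e i ->
    [/\ optimal_nudge D (exec_tri e i) (exec_rho e i),
        nudged_optimal M sI (exec_rho e i) (exec_pol e i) &
        ~ solved_at e i ->
        update D (exec_tri e i) (exec_rho e i) (exec_val e i)
               (exec_tri e i.+1)].

Definition goal_reached e (eps : R) n : Prop :=
  stopped_before e n \/ uncertainty_length (exec_tri e n) <= eps.

Definition calls_required e (eps : R) n : Prop :=
  goal_reached e eps n /\ forall m, goal_reached e eps m -> (n <= m)%N.

End Execution.

(* Main.v *)
Require Import Defs.
From mathcomp Require Import all_boot all_order all_algebra.
From mathcomp Require Import all_classical all_reals all_analysis.
From mathcomp Require Import ring lra.

Import Order.TTheory GRing.Theory Num.Theory.
Local Open Scope ring_scope.

(** In the coordinates p = w - l and q = w + l the line L_v is D (p - rho) = v q,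
   and every triangle of the algorithm has a side AB of constant p below C, with
   0 <= q_A <= q_C <= q_B. Hence points of L_v in the triangle have p <= rho if
   v <= 0 and p >= rho if v >= 0, so u_l^* <= rho - p_B and u_r^* <= p_C - rho.
   The midpoint of the uncertainty interval is therefore a choice of rho whose
   worst case is at most half of the current length, and the minimizing rho_i
   does at least as well: every call halves the length. *)

(** * Coordinates and the shape of the triangles *)

Section Geometry.
Set Implicit Arguments.
Unset Strict Implicit.
Unset Printing Implicit Defensive.
Context {R : realType}.
Implicit Types (X P Q S T : Defs.point R) (Tr : triangle R) (D rho v u : R).

Definition coord2 X : R := wcoord X + lcoord X.

(** Multiplying the slope equation by [D + v] gives a form without denominator, which also covers
    the vertical line [v = - D]. *)
Lemma nudge_lineP D rho v X : 0 < D -> nudge_line D rho v X ->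
  D * (2 * coord1 X - rho) = v * coord2 X.
Proof.
move=> D0; rewrite /nudge_line /coord1 /coord2 /=.
case: ifPn => [/eqP -> -> | vD]; first by field.
have Dv : D + v != 0 by rewrite addrC addr_eq0.
move=> /(congr1 (fun x => (D + v) * x)).
rewrite [X in _ = X -> _]mulrA (mulrC (D + v) (_ / _)) divfK// => E.
by lra.
Qed.

Lemma segmentP P Q X : segment P Q X -> exists t : R,
  [/\ 0 <= t, t <= 1, coord1 X = (1 - t) * coord1 P + t * coord1 Q &
      coord2 X = (1 - t) * coord2 P + t * coord2 Q].
Proof.
move=> [t [t0 t1 wX lX]]; exists t.
by rewrite /coord1 /coord2 wX lX; split=> //; field.
Qed.

Lemma diag_line_coord1 P X : diag_line P X -> coord1 X = coord1 P.
Proof. by rewrite /diag_line /coord1 /= => ?; lra. Qed.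

(** What the invariant keeps of the slope conditions: a slope of AC in [0,1] gives [q_A <= q_C], and
    a slope of BC of absolute value at least 1 gives [q_C <= q_B]. *)
Definition well_shaped Tr : Prop :=
  [/\ coord1 (vA Tr) = coord1 (vB Tr), coord1 (vB Tr) <= coord1 (vC Tr),
      0 <= coord2 (vA Tr), coord2 (vA Tr) <= coord2 (vC Tr) &
      coord2 (vC Tr) <= coord2 (vB Tr)].

Lemma well_shaped_initial D : 0 < D -> well_shaped (initial_triangle D).
Proof. by rewrite /well_shaped /coord1 /coord2 /= => ?; split; lra. Qed.

Lemma segmentAC_bounds Tr X : well_shaped Tr -> segment (vA Tr) (vC Tr) X ->
  [/\ coord1 (vB Tr) <= coord1 X <= coord1 (vC Tr),
      coord2 (vA Tr) <= coord2 X & coord2 X <= coord2 (vC Tr)].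
Proof.
move=> [pAB pBC qA qAC qCB] /segmentP[t [t0 t1 -> ->]].
by split; [apply/andP; split| |]; nra.
Qed.

Lemma segmentBC_bounds Tr X : well_shaped Tr -> segment (vB Tr) (vC Tr) X ->
  [/\ coord1 (vB Tr) <= coord1 X <= coord1 (vC Tr),
      coord2 (vC Tr) <= coord2 X & coord2 X <= coord2 (vB Tr)].
Proof.
move=> [pAB pBC qA qAC qCB] /segmentP[t [t0 t1 -> ->]].
by split; [apply/andP; split| |]; nra.
Qed.

Lemma segmentAB_coord1 Tr X : well_shaped Tr -> segment (vA Tr) (vB Tr) X ->
  coord1 X = coord1 (vB Tr).
Proof. by move=> [pAB _ _ _ _] /segmentP[t [_ _ -> _]]; rewrite pAB; ring. Qed.

(** * Bounds for the worst-case uncertainty *)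

Lemma admissible_gain_bounds Tr rho : admissible_gain Tr rho ->
  2 * coord1 (vB Tr) <= rho <= 2 * coord1 (vC Tr).
Proof. by move=> /andP[? ?]; apply/andP; split; lra. Qed.

Lemma u_l_set_ubound D Tr rho u : 0 < D -> well_shaped Tr ->
  admissible_gain Tr rho -> u_l_set D Tr rho u -> u <= rho - 2 * coord1 (vB Tr).
Proof.
move=> D0 wTr /admissible_gain_bounds/andP[rB rC] [v [v0 _]].
case: ifP => [_ -> | _ [S [T [[_ HS] [[LT ACT] _] ->]]]]; first by lra.
have pS : coord1 (vB Tr) <= coord1 S.
  case: HS => [/(segmentAB_coord1 wTr) -> // |].
  by case/(segmentBC_bounds wTr) => /andP[].
have [_ qT _] := segmentAC_bounds wTr ACT.
have qA : 0 <= coord2 (vA Tr) by case: wTr.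
have := nudge_lineP D0 LT => E.
have : D * (2 * coord1 T - rho) <= 0 by rewrite E; nra.
by rewrite pmulr_rle0// => ?; lra.
Qed.

Lemma u_r_set_ubound D Tr rho u : 0 < D -> well_shaped Tr ->
  admissible_gain Tr rho -> u_r_set D Tr rho u -> u <= 2 * coord1 (vC Tr) - rho.
Proof.
move=> D0 wTr /admissible_gain_bounds/andP[rB rC] [v [v0 _]].
case: ifP => [_ -> | _ [S [T [[_ HS] [[LT ACT] _] ->]]]]; first by lra.
have [/andP[_ pS] _ _] := segmentBC_bounds wTr HS.
have [_ qT _] := segmentAC_bounds wTr ACT.
have qA : 0 <= coord2 (vA Tr) by case: wTr.
have := nudge_lineP D0 LT => E.
have : 0 <= D * (2 * coord1 T - rho) by rewrite E; nra.
by rewrite pmulr_rge0// => ?; lra.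
Qed.

(* The hypothesis [0 <= b] covers the junk value [sup set0 = 0]. *)
Lemma sup_le_of_ubound (E : set R) (b : R) :
  0 <= b -> (forall u, E u -> u <= b) -> sup E <= b.
Proof.
move=> b0 Eb; have [->|/set0P E0] := eqVneq E set0; first by rewrite sup0.
by apply: ge_sup => // u; exact: Eb.
Qed.

Lemma worst_uncertainty_midpoint D Tr : 0 < D -> well_shaped Tr ->
  exists2 rho, admissible_gain Tr rho &
    worst_uncertainty D Tr rho <= uncertainty_length Tr / 2.
Proof.
move=> D0 wTr; have pBC : coord1 (vB Tr) <= coord1 (vC Tr) by case: wTr.
(* Gains are twice [coord1], so this sum is the midpoint of the uncertainty interval; both bounds
   then equal half of its length. *)
pose rho := coord1 (vB Tr) + coord1 (vC Tr).
have adm : admissible_gain Tr rho by apply/andP; rewrite /rho; split; lra.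
have rhoE : rho = coord1 (vB Tr) + coord1 (vC Tr) by [].
exists rho => //; rewrite /worst_uncertainty ge_max /uncertainty_length.
apply/andP; split; apply: sup_le_of_ubound => [|u Eu]; try by lra.
- by have := u_l_set_ubound D0 wTr adm Eu; lra.
- by have := u_r_set_ubound D0 wTr adm Eu; lra.
Qed.

(** * One update of the triangle *)

Lemma segment_triangle_setAC Tr X :
  segment (vA Tr) (vC Tr) X -> triangle_set Tr X.
Proof.
by move=> [t [t0 t1 wX lX]]; exists (1 - t), 0, t; split; [split|..]; lra.
Qed.

(** The new length is itself a member of [u_l_set] if [v < 0] and of [u_r_set] if [v > 0]: the new
    vertices serve as S and T. *)
Lemma update_length_le D Tr Tr' rho v : 0 < D -> well_shaped Tr ->
  admissible_gain Tr rho -> update D Tr rho v Tr' ->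
  uncertainty_length Tr' <= worst_uncertainty D Tr rho.
Proof.
move=> D0 wTr adm upd; rewrite /worst_uncertainty /uncertainty_length le_max.
(* An unbounded set would have the default supremum 0, so boundedness comes first. *)
have ubl : has_ubound (u_l_set D Tr rho).
  by exists (rho - 2 * coord1 (vB Tr)) => u; exact: u_l_set_ubound.
have ubr : has_ubound (u_r_set D Tr rho).
  by exists (2 * coord1 (vC Tr) - rho) => u; exact: u_r_set_ubound.
case: Tr wTr adm upd ubl ubr => A B C wTr adm.
case: Tr' => A' B' C' [[v0 _ [LB AB] TC]|[v0 [LB BC] TC _]|[v0 [LC BC] TA [_ dB]]] ubl ubr /=.
- apply/orP; left; apply: ub_le_sup => //; exists v; split; first exact: ltW.
    by exists C'; case: TC => -[? /segment_triangle_setAC ?] _.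
  by rewrite lt_eqF//; exists B', C'; split=> //; split=> //; left.
- apply/orP; left; apply: ub_le_sup => //; exists v; split; first exact: ltW.
    by exists C'; case: TC => -[? /segment_triangle_setAC ?] _.
  by rewrite lt_eqF//; exists B', C'; split=> //; split=> //; right.
- apply/orP; right; apply: ub_le_sup => //; exists v; split; first exact: ltW.
    by exists A'; case: TA => -[? /segment_triangle_setAC ?] _.
  (* T is A', whose [coord1] is that of B' since A'B' has slope 1. *)
  by rewrite gt_eqF//; exists C', A'; split=> //; rewrite (diag_line_coord1 dB).
Qed.

Lemma update_length_halves D Tr Tr' rho v : 0 < D -> well_shaped Tr ->
  optimal_nudge D Tr rho -> update D Tr rho v Tr' ->
  uncertainty_length Tr' <= uncertainty_length Tr / 2.
Proof.
move=> D0 wTr [adm opt] upd.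
have [mid admmid] := worst_uncertainty_midpoint D0 wTr.
apply: le_trans; apply: le_trans (opt _ admmid).
exact: update_length_le upd.
Qed.

(** Along L the coordinates p and q vary in opposite directions if [v < 0] and in the same direction
    if [v > 0]. A vertex found by the line of slope 1 is compared with its neighbour through their
    parameters on the common side. *)
Lemma well_shaped_update D Tr Tr' rho v : 0 < D -> well_shaped Tr ->
  ~ degenerate Tr -> update D Tr rho v Tr' -> well_shaped Tr'.
Proof.
move=> D0 wTr ndeg upd.
(* Strictness makes p strictly increasing along AC and BC, so an order of p is an order of
   parameters. *)
have pBltC : coord1 (vB Tr) < coord1 (vC Tr).
  case: wTr => pAB pBC _ _ _; rewrite lt_neqAle pBC andbT.
  by apply/eqP => pE; apply: ndeg.
have [pAB pBC qA qAC qCB] := wTr.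
case: Tr Tr' wTr upd pBltC pAB pBC qA qAC qCB {ndeg} => A B C [A' B' C'] wTr /=.
move=> [[v0 -> [LB AB] [[LC AC] _]]|
        [v0 [LB BC] [[LC AC] _] [ACA' /diag_line_coord1 dA]]|
        [v0 [LC BC] [[LA AC] _] [BCB' /diag_line_coord1 dB]]] pBltC pAB pBC qA qAC qCB.
- have := segmentAB_coord1 wTr AB => /= pB'.
  have [/andP[/= pC' _] /= qC' _] := segmentAC_bounds wTr AC.
  split=> /=; rewrite ?pB'//.
  have := nudge_lineP D0 LB; have := nudge_lineP D0 LC => EC EB.
  have : v * coord2 B' <= v * coord2 C'.
    by rewrite -EB -EC ler_pM2l//; lra.
  by rewrite ler_nM2l.
- have [/andP[/= pB' _] /= qB' _] := segmentBC_bounds wTr BC.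
  have [_ /= qAC' qC'] := segmentAC_bounds wTr AC.
  have [_ /= qA' _] := segmentAC_bounds wTr ACA'.
  (* Here [q_C' <= q_C <= q_B'], and [v < 0] reverses the order. *)
  have pB'C' : coord1 B' <= coord1 C'.
    have := nudge_lineP D0 LB; have := nudge_lineP D0 LC => EC EB.
    have : D * (2 * coord1 B' - rho) <= D * (2 * coord1 C' - rho).
      by rewrite EB EC ler_nM2l//; lra.
    by rewrite ler_pM2l//; lra.
  split=> //=; try lra.
  have [t [t0 t1 pt qt]] := segmentP AC.
  have [s [s0 s1 ps qs]] := segmentP ACA'.
  rewrite pAB in pt ps.
  have st : s <= t.
    have : (coord1 C - coord1 B) * s <= (coord1 C - coord1 B) * t by lra.
    by rewrite ler_pM2l// subr_gt0.
  by rewrite qs qt; nra.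
- have [_ /= qC' _] := segmentBC_bounds wTr BC.
  have [_ /= qA' qA'C] := segmentAC_bounds wTr AC.
  (* Here [q_A' <= q_C <= q_C'], and [v > 0] preserves the order. *)
  have pA'C' : coord1 A' <= coord1 C'.
    have := nudge_lineP D0 LA; have := nudge_lineP D0 LC => EC EA.
    have : D * (2 * coord1 A' - rho) <= D * (2 * coord1 C' - rho).
      by rewrite EA EC ler_pM2l//; lra.
    by rewrite ler_pM2l//; lra.
  split=> //=; try lra.
  have [t [t0 t1 pt qt]] := segmentP BC.
  have [s [s0 s1 ps qs]] := segmentP BCB'.
  have st : s <= t.
    have : (coord1 C - coord1 B) * s <= (coord1 C - coord1 B) * t by lra.
    by rewrite ler_pM2l// subr_gt0.
  by rewrite qs qt; nra.
Qed.

End Geometry.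

(** * Counting the solver calls *)

Section Execution.
Set Implicit Arguments.
Unset Strict Implicit.
Unset Printing Implicit Defensive.

Lemma stopped_beforeS (R : realType) (S A : finType) (M : smdp R S A) (sI : S)
    (e : execution R S A) (n : nat) :
  ~ stopped_before M sI e n.+1 -> ~ stopped_before M sI e n /\ ~ stops_at M sI e n.
Proof.
by move=> ns; split=> [[i ilt si]|sn]; apply: ns;
  [exists i => //; exact: ltnW | exists n].
Qed.

Lemma execution_length_le (R : realType) (S A : finType) (M : smdp R S A)
    (sI : S) (D : R) (e : execution R S A) (n : nat) : 0 < D ->
  nudging_execution M sI D e -> ~ stopped_before M sI e n ->
  [/\ well_shaped (exec_tri e n), ~ degenerate (exec_tri e n) &
      uncertainty_length (exec_tri e n) <= D / 2 ^+ n].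
Proof.
move=> D0 [e0 step]; elim: n => [_ | n IH /stopped_beforeS[nsn nst]].
  rewrite e0; split; first exact: well_shaped_initial.
  - by rewrite /degenerate /coord1 /= => -[? ?]; lra.
  - by rewrite /uncertainty_length /coord1 /= expr0; lra.
have [wTr ndeg len] := IH nsn; have [opt _ upd] := step _ nsn.
have {}upd : update D (exec_tri e n) (exec_rho e n) (exec_val M sI e n) (exec_tri e n.+1).
  by apply: upd => solved; apply: nst; left.
split; first exact: well_shaped_update upd.
  (* A degenerate triangle after call [n] counts as stopping at call [n]. *)
  by move=> deg; apply: nst; right.
apply: le_trans (update_length_halves D0 wTr opt upd) _.
by rewrite exprSr invfM mulrA ler_pM2r// invr_gt0.
Qed.

Lemma calls_required_ex (R : realType) (S A : finType) (M : smdp R S A)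
    (sI : S) (e : execution R S A) (eps : R) (n : nat) :
  goal_reached M sI e eps n ->
  exists2 m : nat, calls_required M sI e eps m & (m <= n)%N.
Proof.
move=> gn; have gex : exists k, `[< goal_reached M sI e eps k >].
  by exists n; apply/asboolP.
exists (ex_minn gex); case: ex_minnP => m /asboolP gm min.
  by split=> // k gk; apply: min; apply/asboolP.
by apply: min; apply/asboolP.
Qed.

Lemma exp2_ge_log_bound (R : realType) (x : R) : 2 <= x ->
  exists2 n : nat, x <= 2 ^+ n & n%:R <= 2 / ln 2 * ln x.
Proof.
move=> x2; have x0 : 0 < x by lra.
have ln2 : 0 < ln (2 : R) by apply: ln_gt0; lra.
have lnx : ln 2 <= ln x by rewrite ler_ln ?posrE//; lra.
have q1 : 1 <= ln x / ln 2 by rewrite ler_pdivlMr// mul1r.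
have q0 : 0 <= ln x / ln 2 by lra.
have /andP[tle tgt] := truncn_itv q0.
(* Rounding the binary logarithm costs at most 1, which the factor 2 absorbs because [x >= 2] makes
   that logarithm at least 1. *)
exists (Num.truncn (ln x / ln 2)).+1.
- rewrite -ler_ln ?posrE ?exprn_gt0// lnXn// -[leRHS]mulr_natl -ler_pdivrMr//.
  exact: ltW.
- rewrite mulrAC -mulrA -natr1; lra.
Qed.

End Execution.

Theorem mainTheorem3 (R : realType) :
  exists K r0 : R, 0 < r0 /\
  forall (S A : finType) (M : smdp R S A) (sI : S) (D eps : R)
         (e : execution R S A),
    unichain M ->
    recurrent_state M sI ->
    0 < D ->
    (forall pi : policy, 1 <= cycle_cost M sI pi) ->
    (forall pi : policy, - D <= cycle_reward M sI pi <= D) ->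
    (exists pi : policy, 0 < gain M sI pi) ->
    0 < eps ->
    r0 <= D / eps ->
    nudging_execution M sI D e ->
    exists2 n : nat, calls_required M sI e eps n & n%:R <= K * ln (D / eps).
Proof.
(* Both constants are those of [exp2_ge_log_bound], applied to [D / eps]. *)
exists (2 / ln 2), 2; split=> // S A M sI D eps e _ _ D0 _ _ _ eps0 ratio exe.
have [N De Nle] := exp2_ge_log_bound ratio.
have gN : goal_reached M sI e eps N.
  have [?|ns] := pselect (stopped_before M sI e N); [by left|right].
  have [_ _ len] := execution_length_le D0 exe ns.
  apply: le_trans len _.
  by rewrite ler_pdivrMr ?exprn_gt0//; move: De; rewrite ler_pdivrMr// mulrC.
have [n cn nN] := calls_required_ex gN; exists n => //.
by apply: le_trans Nle; rewrite ler_nat.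
Qed.
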